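(* Let $w=(w_k)_{k\ge0}$ be a weight sequence with $w_0>0$ and $w_k>0$ for some $k\ge1$. Suppose that $n\to\infty$ and $m=m(n)$ with $m/n\to\lambda$, where $0\le\lambda<\infty$. If $\lambda\le\nu$, then $Y_{(1)}=o_p(n)$, i.e., $Y_{(1)}/n\to0$ in probability.
   Context: A weight sequence is a sequence $w=(w_k)_{k\ge0}$ of nonnegative reals. $\Phi(t)=\sum_kw_kt^k$, $\rho$ its radius of convergence; $\Psi(t)=t\Phi'(t)/\Phi(t)$ for $\Phi(t)<\infty$, $\Psi(\rho)=\lim_{t\uparrow\rho}\Psi(t)$ if $\Phi(\rho)=\infty$; $\nu=\Psi(\rho)$. Balls-in-boxes: $\mathcal B_{m,n}=\{(y_1,\dots,y_n)\in\{0,1,\dots\}^n:\sum y_i=m\}$, weight $w(y)=\prod_iw_{y_i}$, $Z(m,n)=\sum_{y\in\mathcal B_{m,n}}w(y)$; when $Z(m,n)>0$, $B_{m,n}=(Y_1,\dots,Y_n)$ is random with $P(B_{m,n}=y)=w(y)/Z(m,n)$ (only $m,n$ with $Z(m,n)>0$ are considered). $Y_{(1)}=\max_iY_i$. *)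

(* Defs.v *)
From HB Require Import structures.
From mathcomp Require Import all_boot all_order all_algebra.
From mathcomp Require Import all_classical all_reals all_analysis.
Set Implicit Arguments. Unset Strict Implicit. Unset Printing Implicit Defensive.
Import Order.TTheory GRing.Theory Num.Theory.
Import numFieldNormedType.Exports.
Local Open Scope classical_set_scope.
Local Open Scope ring_scope.

Section WeightSeq.
Variable R : realType.
Variable w : nat -> R.

Definition Phi (t : R) : \bar R := (\sum_(0 <= k <oo) (w k * t ^+ k)%:E)%E.

Definition dPhi (t : R) : \bar R :=
  (\sum_(0 <= k <oo) ((k%:R * w k) * t ^+ k.-1)%:E)%E.

Definition rho : \bar R :=
  ereal_sup [set t%:E | t in [set t : R | 0 <= t /\ (Phi t < +oo)%E]].

(* Psi(t) = t Phi'(t) / Phi(t), used where Phi(t) < oo *)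
Definition Psi (t : R) : \bar R :=
  (t%:E * dPhi t * ((fine (Phi t))^-1)%:E)%E.

Definition nu : \bar R :=
  match rho with
  | r%:E => if (Phi r < +oo)%E then Psi r
            else lim ((fun t : R => Psi t) @ r^'-)
  | _ => lim ((fun t : R => Psi t) @ +oo)
  end.

(* balls-in-boxes: y : 'I_n -> 'I_(m+1) with sum y_i = m *)
Definition wgt (n m : nat) (y : {ffun 'I_n -> 'I_m.+1}) : R :=
  \prod_(i < n) w (y i).

Definition Zmn (m n : nat) : R :=
  \sum_(y : {ffun 'I_n -> 'I_m.+1} | (\sum_(i < n) (y i : nat))%N == m) wgt y.

Definition probB (m n : nat) (E : {ffun 'I_n -> 'I_m.+1} -> bool) : R :=
  (\sum_(y : {ffun 'I_n -> 'I_m.+1} |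
          ((\sum_(i < n) (y i : nat))%N == m) && E y) wgt y) / Zmn m n.

Definition Ymax (n m : nat) (y : {ffun 'I_n -> 'I_m.+1}) : nat :=
  (\max_(i < n) (y i : nat))%N.

End WeightSeq.

(* Main.v *)
(* A weight of the form w_k tau^k / F changes neither the law of the boxes nor
   the event, so one may assume that w is a probability distribution p with
   mean lambda; tau is the largest t with t Phi'(t) <= lambda Phi(t), and
   lambda <= nu is what forces equality there.  (If lambda = 0 or the support
   of w is bounded, the maximum is trivially o(n).)

   Z(m, n) is the coefficient of t^m in (sum_k p_k t^k)^n, hence
   supermultiplicative.  Concentration of the sum of n independent variables of
   law p, followed by a cheap correction of o(n) boxes to reach m exactly, gives
   Z(m, n) >= exp(-o(n)).  On the other hand, if y_i > eps n, then inserting a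
   factor exp(-theta y_j) for every other box j costs at most
   exp(theta (m - eps n)), so the configurations with a box of size > eps n have
   total weight at most n exp(theta (m - eps n)) (sum_k p_k exp(-theta k))^(n-1).
   Since sum_k p_k exp(-theta k) = exp(-theta lambda + o(theta)), this is at most
   exp(-c n) for some c > 0.  Only the first moment of p is used, so heavy
   tails, which do occur when lambda = nu, are harmless. *)
Require Import Defs.
From HB Require Import structures.
From mathcomp Require Import all_boot all_order all_algebra.
From mathcomp Require Import all_classical all_reals all_analysis.
From mathcomp Require Import ring lra zify.
Import Order.TTheory GRing.Theory Num.Theory.
Import numFieldNormedType.Exports.
Local Open Scope classical_set_scope.
Local Open Scope ring_scope.

(** * An exponential inequality, and Z(m, n) as a coefficient of a power *)

(** Since exp(x) (1 - x) <= 1, it is enough that (1 + x + 2x^2)(1 - x) = 1 + x^2 (1 - 2x) >= 1. *)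
Lemma expR_le_quadratic (R : realType) (x : R) :
  x <= 1 / 2 -> expR x <= 1 + x + 2 * x ^+ 2.
Proof.
move=> hx.
have h1 : 1 - x <= expR (- x) by rewrite expR_ge1Dx.
have h2 : expR x * expR (- x) = 1 by rewrite -expRD subrr expR0.
have h3 := expR_gt0 x.
have h4 : expR x * (1 - x) <= 1 by rewrite -[leRHS]h2 ler_pM2l.
have h5 : 1 <= (1 + x + 2 * x ^+ 2) * (1 - x).
  have -> : (1 + x + 2 * x ^+ 2) * (1 - x) = 1 + x ^+ 2 * (1 - 2 * x) by ring.
  rewrite lerDl mulr_ge0 ?sqr_ge0 //; lra.
have h6 : 0 < 1 - x by lra.
by rewrite -(ler_pM2r h6) (le_trans h4).
Qed.

(** Coefficients of index at most m in a product involve only such coefficients of the factors, so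
    truncations of w at different degrees can be compared up to m. *)
Lemma coef_exp_le (R : realType) (p q : {poly R}) (m : nat) :
  (forall i, (i <= m)%N -> 0 <= p`_i <= q`_i) ->
  forall n i, (i <= m)%N -> 0 <= (p ^+ n)`_i <= (q ^+ n)`_i.
Proof.
move=> hpq; elim=> [|n IH] i hi.
  by rewrite !expr0 lexx coef1 ler0n.
rewrite !exprS !coefM; apply/andP; split.
  apply: sumr_ge0 => j _; apply: mulr_ge0.
    by have /andP[] := hpq j (leq_trans (leq_ord j) hi).
  by have /andP[] := IH (i - j)%N (leq_trans (leq_subr _ _) hi).
apply: ler_sum => j _.
have /andP[a b] := hpq j (leq_trans (leq_ord j) hi).
have /andP[c d] := IH (i - j)%N (leq_trans (leq_subr _ _) hi).
exact: ler_pM.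
Qed.

Lemma Zmn_coef (R : realType) (w : nat -> R) (m n : nat) :
  Zmn w m n = ((\poly_(k < m.+1) w k) ^+ n)`_m.
Proof.
rewrite poly_def -[X in _ ^+ X]card_ord -prodr_const.
rewrite bigA_distr_bigA /= coef_sum /Zmn /wgt big_mkcond /=.
apply: eq_bigr => y _.
have -> : \prod_(i < n) (w (y i) *: 'X^(y i))
        = (\prod_(i < n) w (y i)) *: 'X^(\sum_(i < n) (y i : nat))%N :> {poly R}.
  elim/big_rec3: _ => [|i a b c _ ->]; first by rewrite scale1r expr0.
  by rewrite -scalerAr -scalerAl scalerA exprD mulrC.
by rewrite coefZ coefXn (eq_sym m); case: eqP => _; rewrite ?mulr1 ?mulr0.
Qed.

Lemma coef_le_Zmn (R : realType) (w : nat -> R) (K m n : nat) :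
  (forall k, 0 <= w k) -> ((\poly_(k < K) w k) ^+ n)`_m <= Zmn w m n.
Proof.
move=> w0; rewrite Zmn_coef.
suff H i : (i <= m)%N -> 0 <= (\poly_(k < K) w k)`_i <= (\poly_(k < m.+1) w k)`_i.
  by have /andP[] := coef_exp_le R _ _ m H n m (leqnn m).
by move=> im; rewrite !coef_poly ltnS im; case: ifP => _; rewrite ?lexx w0.
Qed.

Lemma Zmn_coef_wide (R : realType) (w : nat -> R) (K m n : nat) :
  (forall k, 0 <= w k) -> (m < K)%N -> Zmn w m n = ((\poly_(k < K) w k) ^+ n)`_m.
Proof.
move=> w0 mK; apply/eqP; rewrite eq_le coef_le_Zmn // andbT Zmn_coef.
suff H i : (i <= m)%N -> 0 <= (\poly_(k < m.+1) w k)`_i <= (\poly_(k < K) w k)`_i.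
  by have /andP[] := coef_exp_le R _ _ m H n m (leqnn m).
by move=> im; rewrite !coef_poly ltnS im (leq_ltn_trans im mK) lexx w0.
Qed.

Lemma Zmn_ge0 (R : realType) (w : nat -> R) (m n : nat) :
  (forall k, 0 <= w k) -> 0 <= Zmn w m n.
Proof. by move=> w0; apply: sumr_ge0 => y _; apply: prodr_ge0. Qed.

(** Of the Cauchy product of the two powers, whose terms are nonnegative, only the term with m1
    balls in the first n1 boxes is kept. *)
Lemma Zmn_superM (R : realType) (w : nat -> R) (m1 n1 m2 n2 : nat) :
  (forall k, 0 <= w k) ->
  Zmn w m1 n1 * Zmn w m2 n2 <= Zmn w (m1 + m2) (n1 + n2).
Proof.
move=> w0; pose K := (m1 + m2).+1.
rewrite (@Zmn_coef_wide R w K m1) ?ltnS ?leq_addr //.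
rewrite (@Zmn_coef_wide R w K m2) ?ltnS ?leq_addl //.
rewrite (@Zmn_coef_wide R w K (m1 + m2)) // exprD coefM.
have h : (m1 < (m1 + m2).+1)%N by rewrite ltnS leq_addr.
rewrite (bigD1 (Ordinal h)) //= addKn lerDl.
have ge0 n i : (i <= m1 + m2)%N -> 0 <= ((\poly_(k < K) w k) ^+ n)`_i.
  by move=> hi; rewrite -Zmn_coef_wide ?ltnS // Zmn_ge0.
apply: sumr_ge0 => j _; apply: mulr_ge0; apply: ge0; first by rewrite -ltnS.
exact: leq_subr.
Qed.

Lemma Zmn_const_ge (R : realType) (w : nat -> R) (a s : nat) :
  (forall k, 0 <= w k) -> w a ^+ s <= Zmn w (a * s) s.
Proof.
move=> w0; elim: s => [|s IH].
  by rewrite muln0 Zmn_coef !expr0 coef1 eqxx.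
rewrite exprS mulnS -add1n; apply: le_trans (Zmn_superM _ _ _ _ _ _ w0).
apply: ler_pM => //; first by rewrite exprn_ge0.
by rewrite Zmn_coef expr1 coef_poly ltnSn.
Qed.

(* The attainable residues are finitely many, so one representative of each
   suffices; this disposes of the arithmetic of the support of w without
   Frobenius numbers. *)
Lemma Zmn_residue_bound (R : realType) (w : nat -> R) (a : nat) :
  (forall k, 0 <= w k) -> (0 < a)%N ->
  exists A : nat, exists2 z : R, 0 < z &
  forall m n, 0 < Zmn w m n ->
  exists m' n', [/\ (m' <= A)%N, (n' <= A)%N, m' = m %[mod a] & z <= Zmn w m' n'].
Proof.
move=> w0 a0.
suff H c : exists A : nat, exists2 z : R, 0 < z &
  forall m n, (m %% a < c)%N -> 0 < Zmn w m n ->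
  exists m' n', [/\ (m' <= A)%N, (n' <= A)%N, m' = m %[mod a] & z <= Zmn w m' n'].
  have [A [z z0 Hz]] := H a; exists A, z => // m n; apply: Hz.
  by rewrite ltn_mod.
elim: c => [|c [A [z z0 IH]]]; first by exists 0%N, 1.
(* The residue [c] either supplies its own representative, enlarging [A] and shrinking [z], or is
   never attained. *)
case: (pselect (exists m n, (m %% a)%N = c /\ 0 < Zmn w m n)) => [[m1 [n1 [h1 h2]]]|no].
  exists (A + m1 + n1)%N, (Num.min z (Zmn w m1 n1)); first by rewrite lt_min z0.
  move=> m n; rewrite ltnS leq_eqVlt => /orP[/eqP hc _|hc h].
    exists m1, n1; split; [lia|lia|by rewrite h1 hc|by rewrite ge_min lexx orbT].
  have [m' [n' [x1 x2 x3 x4]]] := IH _ _ hc h.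
  exists m', n'; split; [lia|lia|by []|by rewrite ge_min x4].
exists A, z => // m n; rewrite ltnS leq_eqVlt => /orP[/eqP hc h|]; last exact: IH.
by case: no; exists m, n.
Qed.

(** * Lower bound for Z(m, n) when w is a probability distribution with mean lambda *)

Lemma nat_upper_bound (R : realType) (x : R) : exists N : nat, x <= N%:R.
Proof.
exists (Num.bound `|x|); apply: le_trans (ler_norm x) _.
exact/ltW/archi_boundP.
Qed.

(** With u = 1 + c n / 2, exp(c n) >= u^2 while n + 1 <= K1 u. *)
Lemma linear_mul_expRN_lt (R : realType) (c C d : R) : 0 < c -> 0 <= C -> 0 < d ->
  exists N : nat, forall n : nat, (N <= n)%N ->
  C * (n%:R + 1) * expR (- (c * n%:R)) < d.
Proof.
move=> c0 C0 d0.
pose K1 := 1 + 2 / c.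
have K10 : 0 < K1 by rewrite addr_gt0 // divr_gt0.
have [N hN] := nat_upper_bound R (2 * C * K1 / (c * d)).
exists N => n Nn.
have n0 : 0 <= n%:R :> R by [].
have hn : 2 * C * K1 / (c * d) <= n%:R.
  by apply: le_trans hN _; rewrite ler_nat.
have cd0 : 0 < c * d by rewrite mulr_gt0.
rewrite ler_pdivrMr // in hn.
pose u : R := 1 + c / 2 * n%:R.
have u0 : 0 < u by rewrite /u; nra.
have hu : u <= expR (c / 2 * n%:R) by exact: expR_ge1Dx.
have hu2 : u ^+ 2 <= expR (c * n%:R).
  have -> : c * n%:R = c / 2 * n%:R + c / 2 * n%:R :> R by field.
  by rewrite expRD expr2; apply: ler_pM => //; exact: ltW.
have hn1 : n%:R + 1 <= K1 * u.
  have -> : K1 * u = 1 + c / 2 * n%:R + 2 / c + n%:R.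
    by rewrite /K1 /u; field; rewrite gt_eqF.
  have h1 : 0 <= 2 / c by apply: divr_ge0 => //; exact: ltW.
  have h2 : 0 <= c / 2 * n%:R by nra.
  lra.
rewrite expRN ltr_pdivrMr ?expR_gt0 //.
apply: (@lt_le_trans _ _ (d * u ^+ 2)); last by rewrite ler_pM2l.
apply: (@le_lt_trans _ _ (C * (K1 * u))); first by rewrite ler_wpM2l.
have -> : C * (K1 * u) = (C * K1) * u by ring.
have -> : d * u ^+ 2 = (d * u) * u by ring.
rewrite ltr_pM2r //.
have : 2 * (C * K1) <= n%:R * (c * d) by lra.
rewrite /u; nra.
Qed.

(** The first-order term is kept exact, since it carries the mean; [Q] absorbs the second order.
    Both the tails of the window and the bound for a large box rest on this. *)
Lemma sum_mul_expR_le (R : realType) (p f : nat -> R) (K : nat) (Q : R) :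
  (forall k, 0 <= p k) -> (forall k, (k < K)%N -> f k <= 1 / 2) ->
  (forall k, (k < K)%N -> f k ^+ 2 <= Q) ->
  \sum_(0 <= k < K) p k * expR (f k) <=
  (1 + 2 * Q) * (\sum_(0 <= k < K) p k) + \sum_(0 <= k < K) p k * f k.
Proof.
move=> p0 f1 fQ; rewrite mulr_sumr -big_split /=.
rewrite big_nat_cond [leRHS]big_nat_cond.
apply: ler_sum => k /andP[/andP[_ kK] _].
have h := expR_le_quadratic R _ (f1 k kK).
have := fQ k kK.
have := p0 k; nra.
Qed.

(* The truncation at K makes exponential moments finite, so that both sides of
   the window have exponentially small mass; one of the O(n) remaining values of
   M then carries enough of the total mass S^n. *)
Lemma Zmn_window (R : realType) (p : nat -> R) (lambda : R) :
  (forall k, 0 <= p k) ->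
  (forall eta : R, 0 < eta ->
     exists K0, forall K, (K0 <= K)%N -> 1 - eta <= \sum_(0 <= k < K) p k) ->
  (forall K, \sum_(0 <= k < K) (k%:R - lambda) * p k <= 0) ->
  (forall eta : R, 0 < eta ->
     exists K0, forall K, (K0 <= K)%N ->
     - eta <= \sum_(0 <= k < K) (k%:R - lambda) * p k) ->
  0 < lambda ->
  forall delta eta : R, 0 < delta -> 0 < eta ->
  exists N, forall n, (N <= n)%N ->
  exists M : nat, [/\ (lambda - delta) * n%:R <= M%:R,
    M%:R <= (lambda + delta) * n%:R & expR (- (eta * n%:R)) <= Zmn p M n].
Proof.
move=> p0 mass mean_le mean_ge lam0 delta eta d0 e0.
(* This makes the truncated mass S at least 1/2 and at least exp(-eta / 2), so that S^n >= exp(-eta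
   n / 2). *)
pose eta1 : R := Num.min (1 - expR (- (eta / 2))) (1 / 2).
have eta1_gt0 : 0 < eta1.
  by rewrite lt_min subr_gt0 expR_lt1 oppr_lt0 divr_gt0 //= divr_gt0.
have [K1 hK1] := mass eta1 eta1_gt0.
have [K2 hK2] := mean_ge (delta / 4) ltac:(lra).
pose K := (K1 + K2)%N.
have {hK1} hS := hK1 K (leq_addr _ _).
have {hK2} hD := hK2 K (leq_addl _ _).
have {mean_le} hD0 := mean_le K.
set S := \sum_(0 <= k < K) p k in hS.
set D := \sum_(0 <= k < K) _ in hD hD0.
have S12 : 1 / 2 <= S.
  apply: le_trans hS; have : eta1 <= 1 / 2 by rewrite ge_min lexx orbT.
  lra.
have Se : expR (- (eta / 2)) <= S.
  apply: le_trans hS; have : eta1 <= 1 - expR (- (eta / 2)) by rewrite ge_min lexx.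
  lra.
(* [q] bounds the distance from k to lambda + delta and to lambda - delta for all k < K. *)
pose q : R := K%:R + lambda + delta.
have K0 : 0 <= K%:R :> R by [].
have q0 : 0 < q by rewrite /q; lra.
(* The second-order term 2 theta^2 q^2 is now theta delta / 4, half of the available drift theta
   delta / 2; the other half is [c]. *)
pose theta : R := delta / (8 * q ^+ 2).
have t0 : 0 < theta by rewrite divr_gt0 // mulr_gt0 // exprn_gt0.
have tq2 : 8 * (theta * q ^+ 2) = delta.
  by rewrite /theta; field; rewrite gt_eqF.
have tq : theta * q <= 1 / 8.
  have : q * (8 * (theta * q)) <= q * 1.
    have -> : q * (8 * (theta * q)) = 8 * (theta * q ^+ 2) by ring.
    rewrite tq2 mulr1 /q; lra.
  by rewrite ler_pM2l //; lra.
pose c := theta * delta / 4.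
have c0 : 0 < c by rewrite /c divr_gt0 // mulr_gt0.
have Qbound (g : R) : - q <= g <= q -> (theta * g) ^+ 2 <= theta ^+ 2 * q ^+ 2.
  move=> /andP[g1 g2]; rewrite exprMn ler_wpM2l ?sqr_ge0 //.
  have : 0 <= (q - g) * (q + g) by apply: mulr_ge0; lra.
  lra.
have kq (k : nat) : (k < K)%N -> (0 <= k%:R :> R) /\ (k%:R <= K%:R :> R).
  by move=> kK; rewrite ler0n ler_nat ltnW.
have quad : 1 - theta * delta / 2 + 2 * (theta ^+ 2 * q ^+ 2) <= expR (- c).
  apply: le_trans (expR_ge1Dx _); rewrite /c.
  have -> : theta ^+ 2 * q ^+ 2 = theta * (theta * q ^+ 2) by ring.
  nra.
(* Chernoff factor of the upper tail, from D <= 0; the lower tail [hB] uses -D <= delta / 4 <=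
   (delta / 2) S. *)
have hA : \sum_(0 <= k < K) p k * expR (theta * (k%:R - (lambda + delta)))
          <= S * expR (- c).
  have h1 (k : nat) : (k < K)%N -> theta * (k%:R - (lambda + delta)) <= 1 / 2.
    move=> kK; have [hk1 hk2] := kq k kK; have : theta * (k%:R - (lambda + delta)) <= theta * q.
      by rewrite ler_pM2l // /q; lra.
    lra.
  have h2 (k : nat) : (k < K)%N -> (theta * (k%:R - (lambda + delta))) ^+ 2 <= theta ^+ 2 * q ^+ 2.
    by move=> kK; have [hk1 hk2] := kq k kK; apply: Qbound; rewrite /q; apply/andP; split; lra.
  apply: le_trans (sum_mul_expR_le R p _ K _ p0 h1 h2) _ => {h1 h2}.
  have -> : \sum_(0 <= k < K) p k * (theta * (k%:R - (lambda + delta)))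
     = theta * (D - delta * S).
    rewrite /D /S mulr_sumr -sumrB mulr_sumr.
    by apply: eq_bigr => k _; ring.
  rewrite -/S.
  apply: (@le_trans _ _ (S * (1 - theta * delta / 2 + 2 * (theta ^+ 2 * q ^+ 2)))).
    have : theta * D <= 0 by rewrite pmulr_rle0.
    have : 0 <= theta * delta * S by apply: mulr_ge0; [rewrite ltW // mulr_gt0|lra].
    lra.
  by rewrite ler_wpM2l //; lra.
have hB : \sum_(0 <= k < K) p k * expR (theta * ((lambda - delta) - k%:R))
          <= S * expR (- c).
  have h1 (k : nat) : (k < K)%N -> theta * ((lambda - delta) - k%:R) <= 1 / 2.
    move=> kK; have [hk1 hk2] := kq k kK; have : theta * ((lambda - delta) - k%:R) <= theta * q.
      by rewrite ler_pM2l // /q; lra.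
    lra.
  have h2 (k : nat) : (k < K)%N -> (theta * ((lambda - delta) - k%:R)) ^+ 2 <= theta ^+ 2 * q ^+ 2.
    by move=> kK; have [hk1 hk2] := kq k kK; apply: Qbound; rewrite /q; apply/andP; split; lra.
  apply: le_trans (sum_mul_expR_le R p _ K _ p0 h1 h2) _ => {h1 h2}.
  have -> : \sum_(0 <= k < K) p k * (theta * ((lambda - delta) - k%:R))
     = theta * (- D - delta * S).
    rewrite /D /S mulr_sumr -sumrN -sumrB mulr_sumr.
    by apply: eq_bigr => k _; ring.
  rewrite -/S.
  apply: (@le_trans _ _ (S * (1 - theta * delta / 2 + 2 * (theta ^+ 2 * q ^+ 2)))).
    have : theta * (- D) <= theta * (delta / 2 * S).
      by rewrite ler_pM2l //; nra.
    lra.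
  by rewrite ler_wpM2l //; lra.
have [N1 hN1] := linear_mul_expRN_lt R c 1 (1 / 4) c0 ler01 ltac:(lra).
have [N2 hN2] := linear_mul_expRN_lt R (eta / 2) (K%:R + 1) (1 / 2)
   ltac:(lra) ltac:(lra) ltac:(lra).
exists (N1 + N2)%N => n Nn.
have {hN1} hn1 : expR (- (c * n%:R)) <= 1 / 4.
  apply: ltW; apply: le_lt_trans (hN1 n (leq_trans (leq_addr _ _) Nn)).
  by rewrite ler_peMl ?expR_ge0 // mul1r lerDr ler0n.
have {hN2} hn2 := hN2 n (leq_trans (leq_addl _ _) Nn).
pose P : {poly R} := \poly_(k < K) p k.
pose L := (n * K).+1.
have sizeP : (size (P ^+ n) <= L)%N.
  apply: leq_trans (size_poly_exp_leq _ _) _; rewrite ltnS mulnC leq_mul2l.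
  by rewrite (leq_trans (leq_pred _)) ?size_poly ?orbT.
have coefP0 M : 0 <= (P ^+ n)`_M.
  have H i : (i <= M)%N -> 0 <= (0 : {poly R})`_i <= P`_i.
    by move=> _; rewrite coef0 lexx coef_poly /=; case: ifP.
  have /andP[h1 h2] := coef_exp_le R _ _ M H n M (leqnn _).
  exact: le_trans h1 h2.
(* P^n at exp(a), recentred by exp(-a b n): exponential moments of the sum are n-th powers of those
   of one box. *)
have evalP (a b : R) : \sum_(0 <= M < L) (P ^+ n)`_M * expR (a * (M%:R - b * n%:R))
     = (\sum_(0 <= k < K) p k * expR (a * (k%:R - b))) ^+ n.
  have -> : \sum_(0 <= k < K) p k * expR (a * (k%:R - b)) = P.[expR a] * expR (- (a * b)).
    rewrite horner_poly big_mkord mulr_suml; apply: eq_bigr => k _.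
    by rewrite -mulrA -expRM_natl -expRD; congr (_ * expR _); ring.
  rewrite exprMn -horner_exp (horner_coef_wide _ sizeP) big_mkord mulr_suml.
  apply: eq_bigr => k _.
  by rewrite -mulrA -!expRM_natl -expRD; congr (_ * expR _); ring.
pose inside M := ((lambda - delta) * n%:R <= M%:R) && (M%:R <= (lambda + delta) * n%:R :> R).
have [[M [hM1 hM2]]|none] := pselect (exists M, inside M /\ expR (- (eta * n%:R)) <= (P ^+ n)`_M).
  move/andP: hM1 => [? ?]; exists M; split=> //.
  exact: le_trans hM2 (coef_le_Zmn R p K M n p0).
exfalso.
(* Outside the window one of the two exponentials is at least 1; inside it, [none] bounds the
   coefficient. The tails sum to at most S^n / 2 and the rest to less than S^n / 2, which is
   absurd. *)
have tot : S ^+ n <= \sum_(0 <= M < L) (expR (- (eta * n%:R))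
   + (P ^+ n)`_M * expR (theta * (M%:R - (lambda + delta) * n%:R))
   + (P ^+ n)`_M * expR (- theta * (M%:R - (lambda - delta) * n%:R))).
  have -> : S ^+ n = \sum_(0 <= M < L) (P ^+ n)`_M * expR (0 * (M%:R - 0 * n%:R)).
    rewrite evalP; congr (_ ^+ n); apply: eq_bigr => k _.
    by rewrite mul0r expR0 mulr1.
  apply: ler_sum => M _; rewrite mul0r expR0 mulr1.
  have t1 := mulr_ge0 (coefP0 M) (expR_ge0 (theta * (M%:R - (lambda + delta) * n%:R))).
  have t2 := mulr_ge0 (coefP0 M) (expR_ge0 (- theta * (M%:R - (lambda - delta) * n%:R))).
  have t3 := expR_ge0 (- (eta * n%:R)).
  case: (boolP (inside M)) => [hin|].
    have /negP : ~ expR (- (eta * n%:R)) <= (P ^+ n)`_M by move=> h; apply: none; exists M.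
    by rewrite -ltNge => h; lra.
  rewrite negb_and -!ltNge => /orP[] h.
    have e1 : 1 <= expR (- theta * (M%:R - (lambda - delta) * n%:R)).
      by rewrite -[leLHS]expR0 ler_expR mulNr oppr_ge0 pmulr_rle0 // subr_le0 ltW.
    have := ler_wpM2l (coefP0 M) e1; rewrite mulr1; lra.
  have e1 : 1 <= expR (theta * (M%:R - (lambda + delta) * n%:R)).
    by rewrite -[leLHS]expR0 ler_expR pmulr_rge0 // subr_ge0 ltW.
  have := ler_wpM2l (coefP0 M) e1; rewrite mulr1; lra.
move: tot; rewrite !big_split /= !evalP sumr_const_nat subn0 -[_ *+ L]mulr_natl.
have pow (x : R) : x <= S * expR (- c) -> 0 <= x -> x ^+ n <= S ^+ n * (1 / 4).
  move=> hx x0; apply: (@le_trans _ _ ((S * expR (- c)) ^+ n)).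
    by rewrite lerXn2r ?nnegrE // (le_trans x0).
  rewrite exprMn -expRM_natl ler_wpM2l ?exprn_ge0 //; first by lra.
  by rewrite mulrN mulrC.
have sum0 (f : nat -> R) : 0 <= \sum_(0 <= k < K) p k * expR (f k).
  by apply: sumr_ge0 => k _; rewrite mulr_ge0 ?expR_ge0.
have {}hA := pow _ hA (sum0 _).
have hB' : \sum_(0 <= k < K) p k * expR (- theta * (k%:R - (lambda - delta))) <= S * expR (- c).
  apply: le_trans hB; rewrite le_eqVlt; apply/orP; left; apply/eqP.
  apply: eq_bigr => k _; congr (_ * expR _); ring.
have {}hB := pow _ hB' (sum0 _).
have hSn : expR (- (eta / 2 * n%:R)) <= S ^+ n.
  have -> : - (eta / 2 * n%:R) = n%:R * (- (eta / 2)) by ring.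
  by rewrite expRM_natl lerXn2r ?nnegrE ?expR_ge0 //; lra.
have hL : L%:R <= (K%:R + 1) * (n%:R + 1) :> R.
  by rewrite !natr1 -natrM ler_nat /L mulSn addSn ltnS mulnC (leq_trans _ (leq_addl _ _)) // leq_mul2l leqnSn orbT.
have hlast : L%:R * expR (- (eta * n%:R)) < 1 / 2 * expR (- (eta / 2 * n%:R)).
  have -> : - (eta * n%:R) = - (eta / 2 * n%:R) + - (eta / 2 * n%:R) by field.
  rewrite expRD mulrA ltr_pM2r ?expR_gt0 //.
  by apply: le_lt_trans hn2; rewrite ler_wpM2r ?expR_ge0.
clear - hA hB hSn hlast; lra.
Qed.

(* Split the n boxes into n1 = n - n / B boxes with sum M close to lambda n1, n'
   boxes with a sum m' correcting the residue mod a, s boxes with a balls each,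
   and r empty boxes.  Since a >= lambda + 1, the n / B spare boxes have room for
   the missing balls, and they cost only a factor b^(n/B). *)
Lemma Zmn_lower_bound (R : realType) (p : nat -> R) (lambda : R) (a : nat) :
  (forall k, 0 <= p k) -> 0 < p 0%N -> lambda + 1 <= a%:R -> 0 < p a ->
  (forall eta : R, 0 < eta ->
     exists K0, forall K, (K0 <= K)%N -> 1 - eta <= \sum_(0 <= k < K) p k) ->
  (forall K, \sum_(0 <= k < K) (k%:R - lambda) * p k <= 0) ->
  (forall eta : R, 0 < eta ->
     exists K0, forall K, (K0 <= K)%N ->
     - eta <= \sum_(0 <= k < K) (k%:R - lambda) * p k) ->
  0 < lambda ->
  forall eta : R, 0 < eta ->
  exists N, exists2 delta, 0 < delta & forall n m, (N <= n)%N ->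
  (lambda - delta) * n%:R <= m%:R -> m%:R <= (lambda + delta) * n%:R ->
  0 < Zmn p m n -> expR (- (eta * n%:R)) <= Zmn p m n.
Proof.
move=> p_ge0 p0 ha pa mass mean_le mean_ge lam0 eta e0.
have a0 : (0 < a)%N by rewrite -(ltr_nat R); apply: lt_le_trans ha; lra.
have [A [z z0 rep]] := Zmn_residue_bound R p a p_ge0 a0.
pose b := Num.min (Num.min (p 0%N) (p a)) 1.
have b0 : 0 < b by rewrite !lt_min p0 pa ltr01.
have b1 : b <= 1 by rewrite ge_min lexx orbT.
have bp0 : b <= p 0%N by rewrite !ge_min lexx.
have bpa : b <= p a by rewrite !ge_min lexx orbT.
have beta0 : 0 <= - ln b by rewrite oppr_ge0 ln_le0.
(* [B] is large enough for b^(n/B) >= exp(-eta n / 4), and B >= 2 leaves at least half of the boxes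
   for the window. *)
have [B0 hB0] := nat_upper_bound R (4 * (- ln b) / eta).
pose B := B0.+2.
have B_gt0 : 0 < B%:R :> R by rewrite ltr0n.
have hB : 4 * (- ln b) <= eta * B%:R.
  rewrite ler_pdivrMr // [_ * eta]mulrC in hB0; apply: le_trans hB0 _.
  by rewrite ler_pM2l // ler_nat /B; lia.
(* The slack delta n = mu n / (4 B) is small against both lambda n / B, for [MA], and n / B, for
   [sn2]. *)
pose mu := Num.min lambda 1.
have mu0 : 0 < mu by rewrite lt_min lam0 ltr01.
have mu_lam : mu <= lambda by rewrite ge_min lexx.
have mu1 : mu <= 1 by rewrite ge_min lexx orbT.
pose delta := mu / (4 * B%:R).
have d0 : 0 < delta by rewrite divr_gt0 // mulr_gt0.
have [N0 hN0] := @Zmn_window R p lambda p_ge0 mass mean_le mean_ge lam0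
   delta (eta / 4) d0 ltac:(lra).
(* [N1] absorbs the rounding of n / B and the at most [A] boxes and [A] balls of the residue
   correction. *)
have [N1 hN1] := nat_upper_bound R (2 * (A%:R / lambda + 1 + a%:R * A%:R)).
have [N2 hN2] := nat_upper_bound R (2 * - ln z / eta).
exists (2 * N0 + B * N1 + N2 + 1)%N, delta => // n m Nn hm1 hm2 Zpos.
pose n2 := (n %/ B)%N; pose n1 := (n - n2)%N.
have n2n : (n2 * 2 <= n)%N.
  by apply: leq_trans (leq_trunc_div n B); rewrite leq_mul2l /B orbT.
have n1N0 : (N0 <= n1)%N by rewrite /n1; clear - Nn n2n; lia.
have [M [hM1 hM2 hM]] := hN0 n1 n1N0.
have n12 : (n1 + n2 = n)%N by rewrite /n1; clear - n2n; lia.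
have n12R : n1%:R + n2%:R = n%:R :> R by rewrite -natrD n12.
pose x : R := n%:R / B%:R.
have n2x : n2%:R <= x by rewrite /x ler_pdivlMr // -natrM ler_nat leq_trunc_div.
have xn2 : x <= n2%:R + 1.
  rewrite /x ler_pdivrMr // natr1 -natrM ler_nat ltnW //.
  by rewrite {1}(divn_eq n B) mulSn addnC ltn_add2r ltn_mod.
have N1x : N1%:R <= x.
  rewrite /x ler_pdivlMr // -natrM ler_nat mulnC.
  by clear - Nn; lia.
have dn : delta * n%:R = mu * x / 4 by rewrite /delta /x; field; rewrite gt_eqF.
have dn1 : delta * n1%:R <= mu * x / 4.
  by rewrite -dn ler_pM2l // ler_nat /n1 leq_subr.
have xbig : 2 * (A%:R / lambda + 1 + a%:R * A%:R) <= x by apply: le_trans hN1 _.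
have A0 : 0 <= A%:R :> R by [].
have aA0 : 0 <= a%:R * A%:R :> R by rewrite mulr_ge0.
have Al0 : 0 <= A%:R / lambda by rewrite divr_ge0 // ltW.
have lamA : lambda * (A%:R / lambda) = A%:R by field; rewrite gt_eqF.
have x0 : 0 <= x by lra.
have MA : (M + A <= m)%N.
  rewrite -(ler_nat R) natrD.
  have h1 : lambda * x <= lambda * (n2%:R + 1) by rewrite ler_pM2l.
  have h2 : lambda * (2 * (A%:R / lambda + 1)) <= lambda * x by rewrite ler_pM2l //; lra.
  have h3 : mu * x <= lambda * x by rewrite ler_wpM2r.
  have h4 : lambda * n1%:R + lambda * n2%:R = lambda * n%:R by rewrite -mulrDr n12R.
  clear - h1 h2 h3 h4 lamA dn dn1 hM2 hm1.
  lra.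
have Apos : (A <= n2)%N.
  rewrite -(ler_nat R).
  have : 1 * A%:R <= a%:R * A%:R :> R by rewrite ler_wpM2r // ler1n.
  clear - xbig xn2 Al0 A0; lra.
have Zpos1 k : 0 < Zmn p (k * M) (k * n1).
  elim: k => [|k IH]; first by rewrite !mul0n Zmn_coef expr0 coef1 ltr01.
  rewrite !mulSn; apply: lt_le_trans (Zmn_superM R p _ _ _ _ p_ge0).
  by rewrite mulr_gt0 // (lt_le_trans (expR_gt0 _) hM).
(* The sum m + (a - 1) M is congruent to m - M mod a and, unlike m - M, clearly
   attainable. *)
have Zpos2 : 0 < Zmn p (m + a.-1 * M) (n + a.-1 * n1).
  by apply: lt_le_trans (Zmn_superM R p _ _ _ _ p_ge0); rewrite mulr_gt0.
have [m' [n' [m'A n'A hres hz]]] := rep _ _ Zpos2.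
have Mm' : (M + m' <= m)%N by apply: leq_trans MA; rewrite leq_add2l.
(* Modulo a, m' = m + (a - 1) M, so M + m' = m + a M = m. *)
have adv : (a %| m - (M + m'))%N.
  rewrite -eqn_mod_dvd //; apply/eqP.
  rewrite -modnDmr hres modnDmr addnCA -mulSn prednK // addnC mulnC.
  by rewrite modnMDl.
pose s := ((m - (M + m')) %/ a)%N.
have sE : (m = M + (m' + a * s))%N.
  by rewrite mulnC divnK // addnA subnKC.
have n2A : n2%:R - A%:R = (n2 - A)%:R :> R by rewrite natrB.
(* At most lambda n2 + x / 2 balls are left, and the spare boxes can take a (n2 - A) >= (lambda + 1)
   n2 - a A. *)
have sn2 : (s <= n2 - A)%N.
  rewrite -(@leq_pmul2l a) // -(ler_nat R) !natrM natrB //.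
  have h0 : a%:R * s%:R <= m%:R - M%:R :> R.
    by rewrite sE !natrD natrM; have : 0 <= m'%:R :> R by []; lra.
  have h1 : (lambda + 1) * n2%:R <= a%:R * n2%:R by rewrite ler_wpM2r.
  have h2 : mu * x <= x by rewrite ger_pMl //; lra.
  have h4 : lambda * n1%:R + lambda * n2%:R = lambda * n%:R by rewrite -mulrDr n12R.
  clear - h0 h1 h2 h4 dn dn1 hM1 hm2 xbig xn2 Al0 aA0.
  lra.
pose r := (n2 - n' - s)%N.
have nE : (n = n1 + (n' + (s + r)))%N.
  by rewrite /r; clear - n12 sn2 n'A Apos; lia.
have zbound : expR (- (eta / 2 * n%:R)) <= z.
  rewrite -[z]lnK ?posrE // ler_expR.
  have : 2 * - ln z <= n%:R * eta.
    rewrite -ler_pdivrMr //; apply: le_trans hN2 _; rewrite ler_nat.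
    by clear - Nn; lia.
  clear; lra.
have bbound : expR (- (eta / 4 * n%:R)) <= b ^+ (s + r).
  have srn2 : (s + r <= n2)%N by rewrite /r; clear - sn2 n'A Apos; lia.
  apply: (@le_trans _ _ (b ^+ n2)); last first.
    by apply: ler_wiXn2l => //; exact: ltW.
  rewrite -[b]lnK ?posrE // -expRM_natl ler_expR.
  have h1 : n2%:R * (4 * - ln b) <= x * (eta * B%:R).
    by apply: ler_pM => //; rewrite mulr_ge0.
  have h2 : x * (eta * B%:R) = eta * n%:R by rewrite /x; field; rewrite gt_eqF.
  clear - h1 h2; lra.
have Mbound : expR (- (eta / 4 * n%:R)) <= Zmn p M n1.
  apply: le_trans hM; rewrite ler_expR lerN2 ler_pM2l ?ler_nat ?leq_subr //.
  by clear - e0; lra.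
(* Budget: eta / 4 for the window, eta / 2 for the residue correction, eta / 4 for the boxes with a
   or 0 balls. *)
have -> : - (eta * n%:R) = - (eta / 4 * n%:R) + (- (eta / 2 * n%:R) + - (eta / 4 * n%:R)).
  by field.
rewrite !expRD.
have -> : Zmn p m n = Zmn p (M + (m' + a * s)) (n1 + (n' + (s + r))) by rewrite -sE -nE.
apply: le_trans (Zmn_superM R p _ _ _ _ p_ge0).
apply: ler_pM; rewrite ?mulr_ge0 ?expR_ge0 //.
apply: le_trans (Zmn_superM R p _ _ _ _ p_ge0).
apply: ler_pM; rewrite ?expR_ge0 //; first exact: le_trans hz.
apply: le_trans bbound _.
have -> : (a * s = a * s + 0 * r)%N by rewrite mul0n addn0.
apply: le_trans (Zmn_superM R p _ _ _ _ p_ge0).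
rewrite exprD; have b0' := ltW b0.
apply: ler_pM; rewrite ?exprn_ge0 //.
  by apply: le_trans (Zmn_const_ge R p a s p_ge0); rewrite lerXn2r ?nnegrE ?p_ge0.
by apply: le_trans (Zmn_const_ge R p 0 r p_ge0); rewrite lerXn2r ?nnegrE ?p_ge0.
Qed.

(** * Upper bound for the configurations with a large box, and the quotient *)

(** When y_i > eps n, the other boxes hold at most (lambda - 3 eps / 4) n balls, whereas the tilted
    mass of one box is at most exp(-theta (lambda - eps / 2)). The gap eps / 4, times theta, is the
    rate. *)
Lemma sum_wgt_Ymax_le (R : realType) (p : nat -> R) (lambda : R) :
  (forall k, 0 <= p k) ->
  (forall K, \sum_(0 <= k < K) p k <= 1) ->
  (forall eta : R, 0 < eta ->
     exists K0, forall K, (K0 <= K)%N -> 1 - eta <= \sum_(0 <= k < K) p k) ->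
  (forall eta : R, 0 < eta ->
     exists K0, forall K, (K0 <= K)%N ->
     - eta <= \sum_(0 <= k < K) (k%:R - lambda) * p k) ->
  0 < lambda ->
  forall eps : R, 0 < eps ->
  exists c C, [/\ 0 < c, 0 <= C & forall n m : nat,
    m%:R <= (lambda + eps / 4) * n%:R ->
    \sum_(y : {ffun 'I_n -> 'I_m.+1} | ((\sum_(i < n) (y i : nat))%N == m)
       && (eps * n%:R < (Ymax y)%:R)) wgt p y <= C * (n%:R + 1) * expR (- (c * n%:R))].
Proof.
move=> p0 mass1 mass mean_ge lam0 eps e0.
have l0 : 0 < eps / (8 * lambda) by rewrite divr_gt0 // mulr_gt0.
have [K1 hK1] := mass _ l0.
have [K2 hK2] := mean_ge (eps / 8) ltac:(lra).
pose K := (K1 + K2)%N.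
have {hK1} hS := hK1 K (leq_addr _ _).
have {hK2} hD := hK2 K (leq_addl _ _).
pose mean := \sum_(0 <= k < K) k%:R * p k.
have hmean : lambda - eps / 4 <= mean.
  have -> : mean = \sum_(0 <= k < K) (k%:R - lambda) * p k
                   + lambda * \sum_(0 <= k < K) p k.
    by rewrite mulr_sumr -big_split; apply: eq_bigr => k _ /=; ring.
  have : lambda * (1 - eps / (8 * lambda)) <= lambda * \sum_(0 <= k < K) p k.
    by rewrite ler_pM2l.
  have -> : lambda * (1 - eps / (8 * lambda)) = lambda - eps / 8.
    by field; rewrite gt_eqF.
  lra.
(* Chosen to keep the second-order term 2 theta^2 K^2 below theta eps / 4. *)
pose theta := eps / (8 * (K%:R ^+ 2 + 1)).
have K20 : 0 < K%:R ^+ 2 + 1 :> R by rewrite ltr_wpDl // sqr_ge0.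
have t0 : 0 < theta by rewrite divr_gt0 // mulr_gt0.
have tK : theta * K%:R ^+ 2 <= eps / 8.
  have -> : eps / 8 = theta * (K%:R ^+ 2 + 1) by rewrite /theta; field; rewrite gt_eqF.
  by rewrite ler_pM2l // lerDl.
pose g := theta * (lambda - eps / 2).
(* The quadratic bound serves below [K]; from [K] on, exp(-theta k) <= 1 and total mass at most 1
   suffice. *)
have phi_le J : \sum_(0 <= k < J) p k * expR (- (theta * k%:R)) <= expR (- g).
  apply: (@le_trans _ _ (\sum_(0 <= k < K + J) p k * expR (- (theta * k%:R)))).
    rewrite [leRHS](big_cat_nat (n := J)) ?leq_addl //= lerDl.
    by apply: sumr_ge0 => k _; rewrite mulr_ge0 ?expR_ge0.
  have kK (k : nat) : (k < K)%N -> k%:R <= K%:R :> R by move=> kK; rewrite ler_nat ltnW.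
  have h1 (k : nat) : (k < K)%N -> - (theta * k%:R) <= 1 / 2.
    move=> _; have : 0 <= theta * k%:R by rewrite mulr_ge0 // ltW.
    by clear; lra.
  have h2 (k : nat) : (k < K)%N -> (- (theta * k%:R)) ^+ 2 <= theta ^+ 2 * K%:R ^+ 2.
    move=> /kK hk; rewrite sqrrN exprMn ler_wpM2l ?sqr_ge0 //.
    by rewrite lerXn2r ?nnegrE.
  have h := sum_mul_expR_le R p _ K _ p0 h1 h2.
  rewrite (big_cat_nat (n := K)) ?leq_addr //=.
  have tail : \sum_(K <= k < K + J) p k * expR (- (theta * k%:R)) <= \sum_(K <= k < K + J) p k.
    apply: ler_sum => k _; rewrite ler_piMr // -[leRHS]expR0 ler_expR oppr_le0.
    by rewrite mulr_ge0 // ltW.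
  have tot := mass1 (K + J)%N.
  rewrite (big_cat_nat (n := K)) ?leq_addr //= in tot.
  have S1 := mass1 K.
  have meanE : \sum_(0 <= k < K) p k * (- (theta * k%:R)) = - (theta * mean).
    by rewrite mulr_sumr -sumrN; apply: eq_bigr => k _; ring.
  rewrite meanE in h.
  have q1 : theta ^+ 2 * K%:R ^+ 2 <= theta * (eps / 8).
    have -> : theta ^+ 2 * K%:R ^+ 2 = theta * (theta * K%:R ^+ 2) by ring.
    by rewrite ler_pM2l.
  have q2 : theta ^+ 2 * K%:R ^+ 2 * \sum_(0 <= k < K) p k <= theta ^+ 2 * K%:R ^+ 2.
    by rewrite ler_piMr // mulr_ge0 // sqr_ge0.
  have q3 : theta * (lambda - eps / 4) <= theta * mean by rewrite ler_pM2l.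
  apply: le_trans (expR_ge1Dx _); rewrite /g.
  clear - h tail tot q1 q2 q3; lra.
exists (theta * eps / 4), (expR `|g|); split; first by rewrite divr_gt0 // mulr_gt0.
  exact: expR_ge0.
move=> n m hm.
(* Weights tilted by exp(-theta k) in every box but the large one, i. *)
pose G (i j : 'I_n) (k : nat) := p k * (if j == i then 1 else expR (- (theta * k%:R))).
have G0 i j k : 0 <= G i j k by rewrite mulr_ge0 //; case: ifP; rewrite ?expR_ge0.
pose E := expR (theta * (m%:R - eps * n%:R)).
have pointwise (y : {ffun 'I_n -> 'I_m.+1}) (i : 'I_n) :
    (\sum_(i < n) (y i : nat))%N = m -> eps * n%:R < (y i)%:R ->
    wgt p y <= E * \prod_(j < n) G i j (y j).
  move=> ym yi.
  have -> : \prod_(j < n) G i j (y j) = wgt p y * expR (- (theta * (m%:R - (y i)%:R))).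
    rewrite big_split /=; congr (_ * _).
    rewrite (bigD1 i) //= eqxx mul1r.
    rewrite (eq_bigr (fun j : 'I_n => expR (- (theta * (y j)%:R)))); last first.
      by move=> j /negPf ->.
    have rest : \sum_(j < n | j != i) (y j)%:R = m%:R - (y i)%:R :> R.
      rewrite -natr_sum; apply/eqP; rewrite eq_sym subr_eq -natrD addnC; apply/eqP.
      by congr _%:R; rewrite -[LHS]ym (bigD1 i).
    by rewrite -expR_sum sumrN -mulr_sumr rest.
  rewrite mulrCA ler_peMr //; first by apply: prodr_ge0.
  rewrite /E -expRD -[leLHS]expR0 ler_expR.
  have -> : theta * (m%:R - eps * n%:R) + - (theta * (m%:R - (y i)%:R))
    = theta * ((y i)%:R - eps * n%:R) by ring.
  by rewrite mulr_ge0 ?ltW // subr_gt0.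
apply: (@le_trans _ _ (\sum_(i < n) \sum_(y : {ffun 'I_n -> 'I_m.+1})
   E * \prod_(j < n) G i j (y j))).
  rewrite exchange_big /= [leLHS]big_mkcond /=; apply: ler_sum => y _.
  have s0 (i : 'I_n) : 0 <= E * \prod_(j < n) G i j (y j).
    by rewrite mulr_ge0 ?expR_ge0 // prodr_ge0.
  case: ifP => [/andP[/eqP ym hmax]|_]; last exact: sumr_ge0.
  have [i hi] : exists i : 'I_n, eps * n%:R < (y i)%:R.
    apply: contrapT => no.
    move: hmax; rewrite ltNge => /negP; apply.
    rewrite /Ymax; elim/big_ind: _ => [|a b ha hb|i _].
    - by rewrite mulr_ge0 // ltW.
    - by rewrite /maxn; case: ifP.
    - by rewrite leNgt; apply/negP => h; apply: no; exists i.
  rewrite (bigD1 i) //=; apply: le_trans (pointwise y i ym hi) _.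
  by rewrite lerDl sumr_ge0.
(* Free of the constraint on the sum, the sum over y factorises: box i contributes at most 1, each
   of the n - 1 others at most exp(-g). *)
have inner (i : 'I_n) : \sum_(y : {ffun 'I_n -> 'I_m.+1}) E * \prod_(j < n) G i j (y j)
    <= E * expR (- g) ^+ n.-1.
  rewrite -mulr_sumr ler_wpM2l ?expR_ge0 //.
  rewrite -(bigA_distr_bigA (fun j (k : 'I_m.+1) => G i j k)) /= (bigD1 i) //=.
  rewrite -[leRHS]mul1r; apply: ler_pM.
  - exact: sumr_ge0.
  - by apply: prodr_ge0 => j _; apply: sumr_ge0.
  - rewrite (eq_bigr (fun k : 'I_m.+1 => p k)); last by move=> k _; rewrite /G eqxx mulr1.
    by rewrite -(big_mkord xpredT p).
  have -> : expR (- g) ^+ n.-1 = \prod_(j < n | j != i) expR (- g).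
    rewrite prodr_const; congr (_ ^+ _).
    have := cardC1 i; rewrite card_ord => <-; apply: eq_card => j; by rewrite !inE.
  apply: ler_prod => j ji; rewrite sumr_ge0 //=.
  rewrite (eq_bigr (fun k : 'I_m.+1 => p k * expR (- (theta * k%:R)))); last first.
    by move=> k _; rewrite /G (negPf ji).
  by rewrite -(big_mkord xpredT (fun k => p k * expR (- (theta * k%:R)))).
apply: (@le_trans _ _ (\sum_(i < n) E * expR (- g) ^+ n.-1)); first exact: ler_sum.
rewrite sumr_const card_ord -[_ *+ n]mulr_natl.
(* [g] may be negative and [n] may be 0; the factor exp(|g|) covers both. *)
have gn : expR (- g) ^+ n.-1 <= expR `|g| * expR (- (g * n%:R)).
  rewrite -expRM_natl -expRD ler_expR.
  case: (n) => [|n'] /=; first by rewrite mul0r mulr0 oppr0 addr0.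
  rewrite -natr1; have := ler_norm g; lra.
apply: (@le_trans _ _ (n%:R * (E * (expR `|g| * expR (- (g * n%:R)))))).
  apply: ler_wpM2l => //; apply: ler_wpM2l => //; exact: expR_ge0.
have -> : n%:R * (E * (expR `|g| * expR (- (g * n%:R)))) =
  expR `|g| * n%:R * (E * expR (- (g * n%:R))) by ring.
apply: ler_pM; rewrite ?mulr_ge0 ?expR_ge0 //.
  by apply: ler_wpM2l; rewrite ?expR_ge0 // lerDl.
rewrite -expRD ler_expR.
have : theta * m%:R <= theta * ((lambda + eps / 4) * n%:R) by rewrite ler_pM2l.
rewrite /g; lra.
Qed.

(** The numerator decays at rate c, so the lower bound on Z(m, n) is taken with eta = c / 2, leaving
    O(n exp(-c n / 2)). *)
Lemma probB_Ymax_lt (R : realType) (p : nat -> R) (m : nat -> nat) (lambda : R) :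
  (forall k, 0 <= p k) -> 0 < p 0%N ->
  (forall A : nat, exists2 k, (A <= k)%N & 0 < p k) ->
  (forall K, \sum_(0 <= k < K) p k <= 1) ->
  (forall eta : R, 0 < eta ->
     exists K0, forall K, (K0 <= K)%N -> 1 - eta <= \sum_(0 <= k < K) p k) ->
  (forall K, \sum_(0 <= k < K) (k%:R - lambda) * p k <= 0) ->
  (forall eta : R, 0 < eta ->
     exists K0, forall K, (K0 <= K)%N ->
     - eta <= \sum_(0 <= k < K) (k%:R - lambda) * p k) ->
  0 < lambda ->
  (forall d : R, 0 < d -> exists N, forall n, (N <= n)%N ->
     (lambda - d) * n%:R <= (m n)%:R /\ (m n)%:R <= (lambda + d) * n%:R) ->
  forall eps : R, 0 < eps -> forall delta : R, 0 < delta ->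
  exists N : nat, forall n : nat, (N <= n)%N -> 0 < Zmn p (m n) n ->
    @probB R p (m n) n (fun y => eps * n%:R < (Ymax y)%:R) < delta.
Proof.
move=> p_ge0 p0 unb mass1 mass mean_le mean_ge lam0 hm eps e0 delta d0.
have [a ha pa] : exists2 a : nat, lambda + 1 <= a%:R & 0 < p a.
  have [A hA] := nat_upper_bound R (lambda + 1).
  have [a Aa pa] := unb A; exists a => //; apply: le_trans hA _.
  by rewrite ler_nat.
have [c [C [c0 C0 num]]] :=
  @sum_wgt_Ymax_le R p lambda p_ge0 mass1 mass mean_ge lam0 eps e0.
have c20 : 0 < c / 2 by rewrite divr_gt0.
have [N1 [d1 d10 den]] :=
  @Zmn_lower_bound R p lambda a p_ge0 p0 ha pa mass mean_le mean_ge lam0 _ c20.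
have [N2 hN2] := hm _ d10.
have e40 : 0 < eps / 4 by rewrite divr_gt0.
have [N3 hN3] := hm _ e40.
have [N4 hN4] := linear_mul_expRN_lt R (c / 2) C delta c20 C0 d0.
exists (N1 + N2 + N3 + N4)%N => n Nn Zpos.
have [n1 n2 n3 n4] : [/\ N1 <= n, N2 <= n, N3 <= n & N4 <= n]%N.
  by clear - Nn; split; lia.
have [m1 m2] := hN2 n n2.
have [_ m3] := hN3 n n3.
have {}den := den n (m n) n1 m1 m2 Zpos.
have {}num := num n (m n) m3.
have {}hN4 := hN4 n n4.
rewrite /probB ltr_pdivrMr //; apply: le_lt_trans num _.
apply: lt_le_trans (_ : delta * expR (- (c / 2 * n%:R)) <= _); last first.
  by apply: ler_wpM2l => //; exact: ltW.
have -> : - (c * n%:R) = - (c / 2 * n%:R) + - (c / 2 * n%:R) by field.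
by rewrite expRD mulrA ltr_pM2r // expR_gt0.
Qed.

(** * Tilting, partial sums of Phi, and their dependence on t *)

(** Every configuration of m balls in n boxes gets the same factor tau^m / F^n. *)
Lemma probB_tilt (R : realType) (w : nat -> R) (tau F : R) (m n : nat)
    (E : {ffun 'I_n -> 'I_m.+1} -> bool) :
  0 < tau -> 0 < F ->
  probB (fun k => w k * tau ^+ k / F) E = probB w E /\
  (0 < Zmn w m n -> 0 < Zmn (fun k => w k * tau ^+ k / F) m n).
Proof.
move=> t0 F0; pose c := tau ^+ m / F ^+ n.
have c0 : 0 < c by rewrite divr_gt0 ?exprn_gt0.
have wE (y : {ffun 'I_n -> 'I_m.+1}) : (\sum_(i < n) (y i : nat))%N == m ->
    wgt (fun k => w k * tau ^+ k / F) y = c * wgt w y.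
  move=> /eqP ym; rewrite /wgt !big_split /= prodr_const card_ord -expr_sum ym.
  by rewrite exprVn /c; ring.
have sumE (P : pred {ffun 'I_n -> 'I_m.+1}) :
    \sum_(y : {ffun 'I_n -> 'I_m.+1} | ((\sum_(i < n) (y i : nat))%N == m) && P y)
      wgt (fun k => w k * tau ^+ k / F) y =
    c * \sum_(y : {ffun 'I_n -> 'I_m.+1} | ((\sum_(i < n) (y i : nat))%N == m) && P y)
      wgt w y.
  by rewrite mulr_sumr; apply: eq_bigr => y /andP[/wE].
have ZE : Zmn (fun k => w k * tau ^+ k / F) m n = c * Zmn w m n.
  by rewrite /Zmn mulr_sumr; apply: eq_bigr => y /wE.
split; last by rewrite ZE pmulr_rgt0.
by rewrite /probB sumE ZE -mulf_div divff ?mul1r ?gt_eqF.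
Qed.

Lemma Phi_le (R : realType) (w : nat -> R) (t B : R) :
  (forall k, 0 <= w k) -> 0 <= t ->
  (forall K, \sum_(0 <= k < K) w k * t ^+ k <= B) -> (Phi w t <= B%:E)%E.
Proof.
move=> w0 t0 hB; apply: lime_le.
  by apply: is_cvg_nneseries => k _ _; rewrite lee_fin mulr_ge0 ?exprn_ge0.
by apply: nearW => K; rewrite sumEFin lee_fin.
Qed.

Lemma Phi_ge (R : realType) (w : nat -> R) (t : R) (K : nat) :
  (forall k, 0 <= w k) -> 0 <= t ->
  ((\sum_(0 <= k < K) w k * t ^+ k)%:E <= Phi w t)%E.
Proof.
move=> w0 t0; rewrite -sumEFin; apply: nneseries_lim_ge => k _ _.
by rewrite lee_fin mulr_ge0 ?exprn_ge0.
Qed.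

Lemma sum_le_fine_Phi (R : realType) (w : nat -> R) (t : R) (K : nat) :
  (forall k, 0 <= w k) -> 0 <= t -> (Phi w t < +oo)%E ->
  \sum_(0 <= k < K) w k * t ^+ k <= fine (Phi w t).
Proof.
move=> w0 t0 fin; rewrite -lee_fin fineK ?Phi_ge //.
rewrite ge0_fin_numE //; apply: le_trans (Phi_ge R w t 0 w0 t0).
by rewrite big_nil.
Qed.

(** A mean value bound; the factor z turns the exponent k - 1 into k, which also suits k = 0. *)
Lemma subrX_le (R : realType) (x y z : R) (k : nat) :
  0 <= x -> x <= y -> y <= z ->
  z * (y ^+ k - x ^+ k) <= (y - x) * k%:R * z ^+ k.
Proof.
move=> x0 xy yz; have z0 : 0 <= z by lra.
elim: k => [|k IH]; first by rewrite !expr0 subrr !mulr0 mul0r.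
have -> : z * (y ^+ k.+1 - x ^+ k.+1) =
    y * (z * (y ^+ k - x ^+ k)) + (y - x) * (z * x ^+ k) by rewrite !exprS; ring.
have -> : (y - x) * k.+1%:R * z ^+ k.+1 =
    z * ((y - x) * k%:R * z ^+ k) + (y - x) * (z * z ^+ k).
  by rewrite exprS -natr1; ring.
have yx : 0 <= y - x by lra.
apply: lerD.
  apply: (@le_trans _ _ (y * ((y - x) * k%:R * z ^+ k))).
    by apply: ler_wpM2l => //; lra.
  by apply: ler_wpM2r => //; rewrite !mulr_ge0 ?exprn_ge0.
by do 2!apply: ler_wpM2l => //; rewrite lerXn2r ?nnegrE //; lra.
Qed.

(** If (1 + a)^2 <= t / s, Bernoulli gives (t / s)^k >= (1 + a)^(2k) >= (a k)^2. *)
Lemma sqr_natr_expr_le (R : realType) (s t : R) : 0 < s -> s < t ->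
  exists2 c : R, 0 < c & forall k : nat, c * k%:R ^+ 2 * s ^+ k <= t ^+ k.
Proof.
move=> s0 st; pose r := t / s.
have r1 : 1 < r by rewrite /r ltr_pdivlMr // mul1r.
pose a := Num.min ((r - 1) / 3) 1.
have a0 : 0 < a by rewrite lt_min ltr01 divr_gt0 // subr_gt0.
have ar : (1 + a) ^+ 2 <= r.
  have h1 : a <= (r - 1) / 3 by rewrite ge_min lexx.
  have h2 : a <= 1 by rewrite ge_min lexx orbT.
  nra.
exists (a ^+ 2) => [|k]; first by rewrite exprn_gt0.
have -> : t = r * s by rewrite /r; field; rewrite gt_eqF.
have -> : a ^+ 2 * k%:R ^+ 2 = (a * k%:R) ^+ 2 by ring.
rewrite [(r * s) ^+ k]exprMn; apply: ler_wpM2r; first by rewrite exprn_ge0 ?ltW.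
have bern : a * k%:R <= (1 + a) ^+ k.
  elim: (k) => [|j IH]; first by rewrite mulr0 expr0.
  rewrite exprS -natr1.
  have : 1 <= (1 + a) ^+ j by rewrite exprn_ege1 // lerDl ltW.
  nra.
apply: (@le_trans _ _ (((1 + a) ^+ 2) ^+ k)); last first.
  by rewrite lerXn2r // nnegrE ?sqr_ge0 //; lra.
have a1 : 0 <= 1 + a by lra.
have a2 := ltW a0.
by rewrite exprAC lerXn2r // nnegrE ?mulr_ge0 ?exprn_ge0.
Qed.

(* Right continuity at tau, uniform in K, inside the disc of convergence:
   u^k - tau^k is at most (u - tau) k s^(k-1) for tau < u <= s < t, and
   k^2 s^k = O(t^k). *)
Lemma centered_sum_right_le (R : realType) (w : nat -> R) (lambda tau t B eta : R) :
  (forall k, 0 <= w k) -> 0 <= lambda -> 0 <= tau -> tau < t -> 0 < eta ->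
  (forall K, \sum_(0 <= k < K) w k * t ^+ k <= B) ->
  exists2 u, tau < u & forall K,
  \sum_(0 <= k < K) (k%:R - lambda) * (w k * u ^+ k) <=
  \sum_(0 <= k < K) (k%:R - lambda) * (w k * tau ^+ k) + eta.
Proof.
move=> w0 lam0 tau0 taut eta0 hB.
have B0 : 0 <= B by have := hB 0%N; rewrite big_nil.
pose s := (tau + t) / 2.
have taus : tau < s by rewrite /s; lra.
have s0 : 0 < s by lra.
have [c c0 hc] := @sqr_natr_expr_le R s t s0 ltac:(rewrite /s; lra).
(* The first cap keeps tau + h <= s; the second gives h B <= c s eta, which is what remains after
   multiplying by c s. *)
pose h := Num.min (s - tau) (eta * c * s / (B + 1)).
have B10 : 0 < B + 1 by lra.
have ecs0 : 0 < eta * c * s by apply: mulr_gt0 => //; exact: mulr_gt0.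
have h0 : 0 < h by rewrite lt_min subr_gt0 taus divr_gt0.
have hs : h <= s - tau by rewrite ge_min lexx.
have heta : h * (B + 1) <= eta * c * s.
  by rewrite -ler_pdivlMr // ge_min lexx orbT.
exists (tau + h) => [|K]; first by lra.
rewrite -lerBlDl -sumrB -(ler_pM2l (mulr_gt0 c0 s0)).
have hBc : h * B <= c * s * eta by clear - heta h0; lra.
apply: le_trans hBc.
rewrite mulr_sumr; apply: le_trans (_ : h * \sum_(0 <= k < K) w k * t ^+ k <= _); last first.
  by rewrite ler_pM2l.
rewrite mulr_sumr; apply: ler_sum => k _.
have e1 := @subrX_le R tau (tau + h) s k tau0 ltac:(lra) ltac:(lra).
have e2 := hc k.
have e3 : tau ^+ k <= (tau + h) ^+ k by rewrite lerXn2r // ?nnegrE; lra.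
have -> : c * s * ((k%:R - lambda) * (w k * (tau + h) ^+ k)
                   - (k%:R - lambda) * (w k * tau ^+ k)) =
   w k * (c * ((k%:R - lambda) * (s * ((tau + h) ^+ k - tau ^+ k)))) by ring.
have -> : h * (w k * t ^+ k) = w k * (h * t ^+ k) by ring.
apply: ler_wpM2l => //.
apply: (@le_trans _ _ (c * (k%:R * (h * k%:R * s ^+ k)))); last first.
  have -> : c * (k%:R * (h * k%:R * s ^+ k)) = h * (c * k%:R ^+ 2 * s ^+ k) by ring.
  by rewrite ler_pM2l.
rewrite ler_pM2l //.
apply: (@le_trans _ _ (k%:R * (s * ((tau + h) ^+ k - tau ^+ k)))).
  by apply: ler_wpM2r; [rewrite mulr_ge0 ?subr_ge0 // ltW|lra].
apply: ler_wpM2l => //; apply: le_trans e1 _.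
by rewrite addrAC subrr add0r.
Qed.

(** * Existence of the tilt *)

Lemma centered_sum_mono (R : realType) (x : nat -> R) (lambda : R) (K K' : nat) :
  (forall k, 0 <= x k) -> lambda <= K%:R -> (K <= K')%N ->
  \sum_(0 <= k < K) (k%:R - lambda) * x k <=
  \sum_(0 <= k < K') (k%:R - lambda) * x k.
Proof.
move=> x0 lK KK'; rewrite [leRHS](big_cat_nat (n := K)) //= lerDl.
rewrite big_nat_cond; apply: sumr_ge0 => k /andP[/andP[Kk _] _].
by rewrite mulr_ge0 // subr_ge0 (le_trans lK) // ler_nat.
Qed.

(** The partial sums start at 0, decrease while k <= lambda and increase afterwards, so large K
    decide. *)
Lemma centered_sum_le0 (R : realType) (x : nat -> R) (lambda : R) (k1 : nat) :
  (forall k, 0 <= x k) ->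
  (forall K, (k1 <= K)%N -> \sum_(0 <= k < K) (k%:R - lambda) * x k <= 0) ->
  forall K, \sum_(0 <= k < K) (k%:R - lambda) * x k <= 0.
Proof.
move=> x0 h K; case: (lerP lambda K%:R) => [lK|Kl].
  apply: le_trans (h (K + k1)%N (leq_addl _ _)).
  exact: centered_sum_mono (leq_addr _ _).
rewrite big_nat_cond; apply: sumr_le0 => k /andP[/andP[_ kK] _].
rewrite mulr_le0_ge0 // subr_le0 ltW //; apply: lt_trans Kl.
by rewrite ltr_nat.
Qed.

(** Beyond lambda + 1 each x_k is at most its centred term, so the tail is at most lambda times the
    head. *)
Lemma sum_le_of_centered_le0 (R : realType) (x : nat -> R) (lambda : R) :
  (forall k, 0 <= x k) -> 0 <= lambda ->
  (forall K, \sum_(0 <= k < K) (k%:R - lambda) * x k <= 0) ->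
  exists B, forall K, \sum_(0 <= k < K) x k <= B.
Proof.
move=> x0 lam0 hD.
have [k1 hk1] := nat_upper_bound R (lambda + 1).
exists ((1 + lambda) * \sum_(0 <= k < k1) x k) => K.
apply: (@le_trans _ _ (\sum_(0 <= k < k1 + K) x k)).
  by rewrite [leRHS](big_cat_nat (n := K)) ?leq_addl //= lerDl sumr_ge0.
rewrite (big_cat_nat (n := k1)) ?leq_addr //=.
have h := hD (k1 + K)%N; rewrite (big_cat_nat (n := k1)) ?leq_addr //= in h.
have h1 : \sum_(k1 <= k < k1 + K) x k <= \sum_(k1 <= k < k1 + K) (k%:R - lambda) * x k.
  rewrite big_nat_cond [leRHS]big_nat_cond; apply: ler_sum => k /andP[/andP[Kk _] _].
  rewrite ler_peMl // lerBrDr addrC (le_trans hk1) // ler_nat //.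
have h2 : - (lambda * \sum_(0 <= k < k1) x k) <= \sum_(0 <= k < k1) (k%:R - lambda) * x k.
  rewrite mulr_sumr -sumrN; apply: ler_sum => k _.
  by rewrite -mulNr ler_wpM2r // lerDr.
lra.
Qed.

Lemma exists_tilt (R : realType) (w : nat -> R) (lambda : R) :
  (forall k, 0 <= w k) -> 0 < w 0%N ->
  (forall A : nat, exists2 k, (A <= k)%N & 0 < w k) ->
  0 < lambda -> (lambda%:E <= nu w)%E ->
  exists2 tau : R, 0 < tau & [/\ (Phi w tau < +oo)%E,
    forall K, \sum_(0 <= k < K) (k%:R - lambda) * (w k * tau ^+ k) <= 0 &
    forall eta : R, 0 < eta -> exists K0, forall K, (K0 <= K)%N ->
      - eta <= \sum_(0 <= k < K) (k%:R - lambda) * (w k * tau ^+ k)].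
Proof.
move=> w0 w00 unb lam0 lam_nu.
pose D (K : nat) (t : R) := \sum_(0 <= k < K) (k%:R - lambda) * (w k * t ^+ k).
have x0 (t : R) : 0 <= t -> forall k, 0 <= w k * t ^+ k.
  by move=> t0 k; rewrite mulr_ge0 ?exprn_ge0.
(* The condition on all [K] encodes t Phi'(t) <= lambda Phi(t) together with finiteness of
   Phi(t). *)
pose T := [set t : R | 0 <= t /\ forall K, D K t <= 0].
have [k1 hk1] := nat_upper_bound R (lambda + 1).
have T0 : T 0.
  split=> //; apply: (@centered_sum_le0 R _ lambda 1) => [|K K1]; first exact: x0.
  rewrite (big_cat_nat (n := 1)) //= big_nat1 expr0 mulr1 sub0r big_nat_cond.
  rewrite big1 ?addr0; first by rewrite mulNr oppr_le0 mulr_ge0 // ltW.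
  by move=> k /andP[/andP[k1' _] _]; rewrite expr0n gtn_eqF // !mulr0.
have [k2 k12 wk2] := unb k1.+1.
pose W := \sum_(0 <= k < k2) w k.
(* For t > 1 the term k2 is at least w_k2 t^k2 and the lower ones together at least -lambda W t^(k2
   - 1), which bounds t. *)
have Tub : has_ubound T.
  exists (1 + lambda * W / w k2) => t [t0 hD].
  have q0 : 0 <= lambda * W / w k2.
    by rewrite divr_ge0 ?mulr_ge0 ?sumr_ge0 // ltW.
  case: (lerP t 1) => [|t1]; first by lra.
  have := hD k2.+1; rewrite /D big_nat_recr //= => h.
  have t1' := ltW t1.
  have k2E : k2 = k2.-1.+1 by rewrite prednK // (leq_ltn_trans _ k12).
  have low : - (lambda * W * t ^+ k2.-1) <= \sum_(0 <= k < k2) (k%:R - lambda) * (w k * t ^+ k).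
    rewrite /W mulr_sumr mulr_suml -sumrN big_nat_cond [leRHS]big_nat_cond.
    apply: ler_sum => k /andP[/andP[_ kk2] _].
    have : w k * t ^+ k <= w k * t ^+ k2.-1.
      by rewrite ler_wpM2l // ler_weXn2l // -ltnS -k2E.
    have : 0 <= k%:R * (w k * t ^+ k) by rewrite mulr_ge0 // x0.
    clear - lam0; nra.
  have k2l : 1 <= k2%:R - lambda.
    by rewrite lerBrDr addrC (le_trans hk1) // ler_nat ltnW // ltnW.
  have up : w k2 * t ^+ k2 <= (k2%:R - lambda) * (w k2 * t ^+ k2).
    by rewrite ler_peMl // x0.
  have : w k2 * t * t ^+ k2.-1 <= lambda * W * t ^+ k2.-1.
    by rewrite -mulrA -exprS -k2E; lra.
  rewrite ler_pM2r ?exprn_gt0 //; last by lra.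
  rewrite mulrC -ler_pdivlMr //; lra.
pose tau := sup T.
have tau0 : 0 <= tau by apply: ub_le_sup.
(* [D K] is a polynomial, so positivity at tau would persist at points of [T] close to tau. *)
have Dtau K : D K tau <= 0.
  rewrite leNgt; apply/negP => Dpos.
  pose P : {poly R} := \poly_(k < K) ((k%:R - lambda) * w k).
  have DP t : D K t = P.[t].
    by rewrite /D horner_poly big_mkord; apply: eq_bigr => k _; rewrite mulrA.
  have := @continuous_horner R P tau; rewrite /= => /cvgrPdist_lt /(_ _ Dpos).
  move=> /nbhs_ballP[e /= e0 he].
  have [t Tt tlt] := sup_adherent e0 (conj (ex_intro _ 0 T0) Tub).
  have ttau : t <= tau by apply: ub_le_sup.
  have := he t; rewrite /ball /= -!DP => /(_ _).
  have -> : `|tau - t| = tau - t by rewrite ger0_norm // subr_ge0.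
  move=> /(_ ltac:(rewrite -/tau in tlt; lra)).
  rewrite ltr_norml => /andP[_ ?]; have [_ /(_ K)] := Tt; lra.
have [B hB] := @sum_le_of_centered_le0 R _ lambda (x0 _ tau0) (ltW lam0) Dtau.
have Phi_fin : (Phi w tau < +oo)%E.
  by apply: le_lt_trans (Phi_le R w tau B w0 tau0 hB) _; rewrite ltry.
have Dto0 : forall eta : R, 0 < eta -> exists K0, forall K, (K0 <= K)%N -> - eta <= D K tau.
  move=> eta e0; apply: contrapT => no.
  (* From [k1] on, [D K tau] is nondecreasing in [K], so it can never reach -eta. *)
  have Dlt K : (k1 <= K)%N -> D K tau < - eta.
    move=> kK; rewrite ltNge; apply/negP => h; apply: no; exists K => K' KK'.
    apply: le_trans h _; apply: centered_sum_mono (x0 _ tau0) _ KK'.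
    by have : k1%:R <= K%:R :> R; [rewrite ler_nat|lra].
  (* If Phi is finite beyond tau, the gap eta leaves room for some u > tau in [T], contradicting the
     supremum. *)
  case: (pselect (exists t, tau < t /\ (Phi w t < +oo)%E)) => [[t [taut fin]]|none].
    have t0 : 0 <= t by lra.
    have [u tauu hu] := @centered_sum_right_le R w lambda tau t _ eta w0 (ltW lam0)
      tau0 taut e0 (fun K => sum_le_fine_Phi R w t K w0 t0 fin).
    have u0 : 0 <= u by lra.
    have : T u.
      split=> //; apply: (@centered_sum_le0 R _ lambda k1) => [|K kK]; first exact: x0.
      by have := hu K; have := Dlt K kK; rewrite /D; lra.
    by move=> /(ub_le_sup Tub); rewrite -/tau; lra.
  (* Now Phi is infinite beyond tau, and lambda <= nu = Psi(tau) applies. *)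
  have rhoE : rho w = tau%:E.
    apply/eqP; rewrite eq_le; apply/andP; split.
      apply: ge_ereal_sup => _ [t [t0 fin] <-]; rewrite lee_fin leNgt.
      by apply/negP => h; apply: none; exists t.
    by apply: ereal_sup_ubound; exists tau.
  move: lam_nu; rewrite /nu rhoE Phi_fin; apply/negP; rewrite -ltNge.
  set F := fine (Phi w tau).
  have hF K : \sum_(0 <= k < K) w k * tau ^+ k <= F by exact: sum_le_fine_Phi.
  have F0 : 0 < F.
    by have := hF 1%N; rewrite big_nat1 expr0 mulr1; lra.
  (* Letting K grow in D K tau < -eta gives Psi(tau) <= lambda - eta / F < lambda. *)
  have dPhiE : (tau%:E * dPhi w tau <= (lambda * F - eta)%:E)%E.
    rewrite /dPhi -nneseriesZl; last first.
      by move=> k _; rewrite lee_fin !mulr_ge0 ?exprn_ge0.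
    apply: lime_le.
      apply: is_cvg_nneseries => k _ _.
      by rewrite -EFinM lee_fin !mulr_ge0 ?exprn_ge0.
    exists k1 => // K /= kK.
    under eq_bigr do rewrite -EFinM.
    rewrite sumEFin lee_fin.
    have -> : \sum_(0 <= k < K) tau * (k%:R * w k * tau ^+ k.-1) =
        D K tau + lambda * \sum_(0 <= k < K) w k * tau ^+ k.
      rewrite /D mulr_sumr -big_split; apply: eq_bigr => k _ /=.
      by case: k => [|k]; rewrite ?exprS /=; ring.
    have := Dlt K kK; have : lambda * \sum_(0 <= k < K) w k * tau ^+ k <= lambda * F.
      by rewrite ler_pM2l.
    lra.
  rewrite /Psi -/F.
  apply: (@le_lt_trans _ _ ((lambda * F - eta)%:E * (F^-1)%:E)%E).
    by apply: lee_wpmul2r => //; rewrite lee_fin invr_ge0 ltW.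
  by rewrite -EFinM lte_fin ltr_pdivrMr //; lra.
exists tau; last by split.
(* At tau = 0 every nonempty centred sum would be -lambda w_0, which is not close to 0. *)
rewrite lt_neqAle tau0 andbT; apply/negP => /eqP tauE.
have lw0 : 0 < lambda * w 0%N / 2 by rewrite divr_gt0 // mulr_gt0.
have [K0 hK0] := Dto0 _ lw0.
have := hK0 K0.+1 (leqnSn _).
rewrite /D -tauE big_nat_recl //= expr0 mulr1 sub0r big1.
  by have := mulr_gt0 lam0 w00; lra.
by move=> k _; rewrite expr0n /= !mulr0.
Qed.

(** * Degenerate cases, and normalisation to a probability distribution *)

Theorem theorem18p2 (R : realType) (w : nat -> R) (m : nat -> nat) (lambda : R) :
  (forall k, 0 <= w k) -> 0 < w 0%N -> (exists k, (0 < k)%N /\ 0 < w k) ->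
  0 <= lambda ->
  (fun n : nat => (m n)%:R / n%:R : R) @ \oo --> lambda ->
  (lambda%:E <= nu w)%E ->
  forall eps : R, 0 < eps -> forall delta : R, 0 < delta ->
  exists N : nat, forall n : nat, (N <= n)%N -> 0 < Zmn w (m n) n ->
    @probB R w (m n) n (fun y => eps * n%:R < (Ymax y)%:R) < delta.
Proof.
move=> w0 w00 _ lam_ge0 cvg_m lam_nu eps e0 delta d0.
have window (d : R) : 0 < d -> exists N, forall n, (N <= n)%N ->
   (lambda - d) * n%:R <= (m n)%:R /\ (m n)%:R <= (lambda + d) * n%:R.
  move=> dpos; have /cvgrPdist_lt /(_ d dpos) [N _ hN] := cvg_m.
  exists N.+1 => n Nn; have := hN n (ltnW Nn) => /=.
  have n0 : 0 < n%:R :> R by rewrite ltr0n (leq_ltn_trans _ Nn).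
  rewrite ltr_norml => /andP[h1 h2].
  split.
    by rewrite -ler_pdivlMr //; lra.
  by rewrite -ler_pdivrMr //; lra.
(* In the degenerate cases the numerator itself vanishes. *)
have small (n : nat) : (forall y : {ffun 'I_n -> 'I_(m n).+1},
      (\sum_(i < n) (y i : nat))%N == m n -> wgt w y = 0 \/ (Ymax y)%:R <= eps * n%:R) ->
    @probB R w (m n) n (fun y => eps * n%:R < (Ymax y)%:R) < delta.
  move=> h; rewrite /probB big1 ?mul0r // => y /andP[/h[//|]].
  by rewrite leNgt => /negPf ->.
case: (eqVneq lambda 0) => [lamE|lam_neq0].
  have [N hN] := window eps e0; exists N => n Nn _.
  apply: small => y /eqP ym; right.
  have [_ ] := hN n Nn; rewrite lamE add0r; apply: le_trans.
  rewrite ler_nat; apply/bigmax_leqP => i _.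
  by rewrite -[leqRHS]ym (bigD1 i) //= leq_addr.
case: (pselect (forall A : nat, exists2 k, (A <= k)%N & 0 < w k)) => [unb|bnd]; last first.
  have [A hA] : exists A : nat, forall k, (A <= k)%N -> w k = 0.
    apply: contrapT => no; apply: bnd => A; apply: contrapT => no'.
    apply: no; exists A => k Ak; apply/eqP; rewrite eq_le w0 andbT leNgt.
    by apply/negP => wk; apply: no'; exists k.
  have [N hN] := nat_upper_bound R (A%:R / eps).
  exists N => n Nn _; apply: small => y _.
  case: (leqP (Ymax y) A) => [hY|].
    right; apply: (@le_trans _ _ A%:R); first by rewrite ler_nat.
    by rewrite mulrC -ler_pdivrMr // (le_trans hN) // ler_nat.
  rewrite ltnNge => hY; left.
  have [i hi] : exists i, (A <= y i)%N.
    apply: contrapT => no; move/negP: hY; apply; apply/bigmax_leqP => i _.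
    by rewrite leqNgt; apply/negP => h; apply: no; exists i; exact: ltnW.
  by rewrite /wgt (bigD1 i) //= hA ?mul0r.
have lam0 : 0 < lambda by rewrite lt_neqAle eq_sym lam_neq0.
have [tau tau0 [Phi_fin Dle Dge]] := exists_tilt R w lambda w0 w00 unb lam0 lam_nu.
set F := fine (Phi w tau).
have hF K : \sum_(0 <= k < K) w k * tau ^+ k <= F.
  by apply: sum_le_fine_Phi => //; exact: ltW.
have F0 : 0 < F by have := hF 1%N; rewrite big_nat1 expr0 mulr1; lra.
pose p k := w k * tau ^+ k / F.
have pE K : \sum_(0 <= k < K) p k = (\sum_(0 <= k < K) w k * tau ^+ k) / F.
  by rewrite mulr_suml.
have DE K : \sum_(0 <= k < K) (k%:R - lambda) * p k =
    (\sum_(0 <= k < K) (k%:R - lambda) * (w k * tau ^+ k)) / F.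
  by rewrite mulr_suml; apply: eq_bigr => k _; rewrite mulrA.
have p_ge0 k : 0 <= p k by rewrite /p divr_ge0 ?mulr_ge0 ?exprn_ge0 // ltW.
have p_gt0 k : 0 < w k -> 0 < p k.
  by move=> wk; rewrite /p divr_gt0 ?mulr_gt0 ?exprn_gt0.
have punb (A : nat) : exists2 k, (A <= k)%N & 0 < p k.
  by have [k Ak wk] := unb A; exists k => //; exact: p_gt0.
have mass1 K : \sum_(0 <= k < K) p k <= 1 by rewrite pE ler_pdivrMr // mul1r.
have mass (eta : R) : 0 < eta ->
    exists K0, forall K, (K0 <= K)%N -> 1 - eta <= \sum_(0 <= k < K) p k.
  (* Were all partial masses below 1 - eta, Phi(tau) would be at most (1 - eta) F < F. *)
  move=> eta0; apply: contrapT => no.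
  suff : (Phi w tau <= ((1 - eta) * F)%:E)%E.
    have -> : Phi w tau = F%:E.
      rewrite fineK // ge0_fin_numE //.
      by apply: le_trans (Phi_ge R w tau 0 w0 (ltW tau0)); rewrite big_nil.
    by rewrite lee_fin; nra.
  apply: Phi_le => //; first exact: ltW.
  move=> K; rewrite leNgt; apply/negP => h; apply: no; exists K => K' KK'.
  rewrite pE ler_pdivlMr // (le_trans (ltW h)) //.
  rewrite [leRHS](big_cat_nat (n := K)) //= lerDl sumr_ge0 // => k _.
  by rewrite mulr_ge0 // exprn_ge0 // ltW.
have mean_le K : \sum_(0 <= k < K) (k%:R - lambda) * p k <= 0.
  by rewrite DE pmulr_lle0 // invr_gt0.
have mean_ge (eta : R) : 0 < eta -> exists K0, forall K, (K0 <= K)%N ->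
    - eta <= \sum_(0 <= k < K) (k%:R - lambda) * p k.
  move=> eta0; have [K0 hK0] := Dge (eta * F) (mulr_gt0 eta0 F0).
  by exists K0 => K KK; rewrite DE ler_pdivlMr // mulNr hK0.
have [N hN] := @probB_Ymax_lt R p m lambda p_ge0 (p_gt0 _ w00) punb mass1 mass
  mean_le mean_ge lam0 window eps e0 delta d0.
exists N => n Nn Zpos.
have [<- Ztilt] := @probB_tilt R w tau F (m n) n
  (fun y => eps * n%:R < (Ymax y)%:R) tau0 F0.
exact: hN n Nn (Ztilt Zpos).
Qed.
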